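(* Let $G=(I\uplus S\uplus O,E)$ be an $(n,p)$-balancer such that, when all input capacities are $1$ (and all output capacities are $1$), the steady-state has no saturated arc. Then \[|S|\ \ge\ \frac12\,|I|\,|O|\sum_{k\in\mathbb{N}}\frac{k}{2^k}\,b_k\!\left(\frac{1}{|O|}\right),\] where $b_k(x)\in\{0,1\}$ denotes the digit of weight $2^{-k}$ in the binary expansion of $x\in[0,1]$.
   Context: A splitter network is a finite directed graph $G$ (loops and parallel arcs allowed) with arc set $E$ whose vertex set is partitioned as $I\uplus S\uplus O$, where each input $i\in I$ has out-degree $1$ and in-degree $0$, each output $o\in O$ has in-degree $1$ and out-degree $0$, and each splitter $s\in S$ has in-degree $2$ and out-degree $2$. $\delta^+(v),\delta^-(v)$ denote outgoing/incoming arcs of $v$, and $\delta^-(O)$ the set of arcs entering outputs. A capacity function is a map $c:I\cup O\to[0,1]$. A steady-state for $(G,c)$ is a pair $(t,F)$ with $t:E\to[0,1]$ and $F\subseteq E$ (fluid arcs; arcs of $E\setminus F$ are saturated) such that: (R3) for each input $i$ with $\delta^+(i)=\{e\}$, $t(e)\le c(i)$, and if $e\in F$ then $t(e)=c(i)$; (R4) for each output $o$ with $\delta^-(o)=\{e\}$, $t(e)\le c(o)$, and if $e\notin F$ then $t(e)=c(o)$; (R5) for each splitter $s$, $t(\delta^-(s))=t(\delta^+(s))$; (R6) for each splitter $s$ with $\delta^-(s)=\{e_1,e_2\}$ and $e_1\notin F$, $t(e_1)\ge t(e_2)$; (R7) for each splitter $s$ with $\delta^+(s)=\{e_1,e_2\}$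 and $e_1\in F$, $t(e_1)\ge t(e_2)$; (R8) for any arcs $uv\in E\setminus F$ and $vw\in F$, $t(uv)=1$ or $t(vw)=1$. A splitter network is a balancer if for every capacity function $c$ with $c(o)=1$ for all $o\in O$ there is a steady-state $(t,F)$ for $(G,c)$ with $t$ constant on $\delta^-(O)$. An $(n,p)$-balancer is a balancer with $|I|=n$ and $|O|=p$. *)

(* Defs.v *)
From HB Require Import structures.
From mathcomp Require Import all_boot all_order all_algebra.
From mathcomp Require Import all_classical all_reals all_analysis.

Set Implicit Arguments.
Unset Strict Implicit.
Unset Printing Implicit Defensive.

Import Order.TTheory GRing.Theory Num.Theory.

Local Open Scope ring_scope.

(* Parallel arcs are distinct elements of [arcs] with the same endpoints. *)
Record digraph (V : finType) := Digraph {
  arcs : finType;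
  src : arcs -> V;
  tgt : arcs -> V
}.

Definition out_arcs (V : finType) (G : digraph V) (v : V) : {set arcs G} :=
  [set e | src e == v].

Definition in_arcs (V : finType) (G : digraph V) (v : V) : {set arcs G} :=
  [set e | tgt e == v].

Record splitter_network := SplitterNetwork {
  input : finType;
  splitter : finType;
  output : finType;
  graph :> digraph (input + splitter + output)%type;
  out_input : forall i, #|out_arcs graph (inl (inl i))| = 1%N;
  in_input : forall i, #|in_arcs graph (inl (inl i))| = 0%N;
  in_output : forall o, #|in_arcs graph (inr o)| = 1%N;
  out_output : forall o, #|out_arcs graph (inr o)| = 0%N;
  in_splitter : forall s, #|in_arcs graph (inl (inr s))| = 2%N;
  out_splitter : forall s, #|out_arcs graph (inl (inr s))| = 2%N
}.

Section Network.
Variables (R : realType) (G : splitter_network).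

Definition input_vertex (i : input G) : input G + splitter G + output G :=
  inl (inl i).
Definition splitter_vertex (s : splitter G) : input G + splitter G + output G :=
  inl (inr s).
Definition output_vertex (o : output G) : input G + splitter G + output G :=
  inr o.

Definition is_capacity (c : input G + output G -> R) : Prop :=
  forall v, 0 <= c v <= 1.

(* [F] is the set of fluid arcs; its complement is the set of saturated arcs. *)
Record steady_state (c : input G + output G -> R)
    (t : arcs G -> R) (F : {set arcs G}) : Prop := SteadyState {
  throughput_bounds : forall e, 0 <= t e <= 1;
  input_rule : forall i e, out_arcs G (input_vertex i) = [set e] ->
    t e <= c (inl i) /\ (e \in F -> t e = c (inl i));
  output_rule : forall o e, in_arcs G (output_vertex o) = [set e] ->
    t e <= c (inr o) /\ (e \notin F -> t e = c (inr o));
  conservation_rule : forall s,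
    \sum_(e in in_arcs G (splitter_vertex s)) t e =
    \sum_(e in out_arcs G (splitter_vertex s)) t e;
  saturated_in_rule : forall s e1 e2,
    in_arcs G (splitter_vertex s) = [set e1; e2] ->
    e1 \notin F -> t e1 >= t e2;
  fluid_out_rule : forall s e1 e2,
    out_arcs G (splitter_vertex s) = [set e1; e2] ->
    e1 \in F -> t e1 >= t e2;
  maximality_rule : forall e f, tgt e = src f ->
    e \notin F -> f \in F -> t e = 1 \/ t f = 1
}.

Definition output_arcs : {set arcs G} :=
  \bigcup_(o : output G) in_arcs G (output_vertex o).

Definition balancer : Prop :=
  forall c : input G + output G -> R,
    is_capacity c -> (forall o, c (inr o) = 1) ->
    exists t F, steady_state c t F /\
      {in output_arcs &, forall e f, t e = t f}.

Definition np_balancer (n p : nat) : Prop :=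
  [/\ balancer, #|input G| = n & #|output G| = p].

End Network.

(* Digit of weight [2^-k] of [0 <= x <= 1], as the parity of the integer part
   of [2^k x]; on dyadic rationals this selects the terminating expansion, and
   [binary_digit 0 1 = 1]. *)
Definition binary_digit (R : realType) (k : nat) (x : R) : nat :=
  odd (Num.truncn (2 ^+ k * x)).

(* Main.v *)
(* Let x_k^i(e) be the mass on the arc e after k steps when input i emits a unit
   that every splitter halves. For input capacity 2^-|E| at i and 0 elsewhere,
   a saturated arc leading to an output would force more than 2^-|E| out of that
   output, so all these arcs are fluid, the throughput on them dominates the
   halving flow, and the balancing hypothesis bounds the mass absorbed by each output by 1/p.
   The mass absorbed within k steps is a multiple of 2^-k, hence at most the
   truncation of 1/p to k binary digits; by Abel summation the expected number
   of splitter visits from i is at least p * sum_k k 2^-k b_k(1/p). Summed over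
   i, these visits are at most the total throughput of the arcs leaving splitters
   in the all-fluid steady state, which is at most 2|S|. *)
Require Import Defs.
From HB Require Import structures.
From mathcomp Require Import all_boot all_order all_algebra.
From mathcomp Require Import all_classical all_reals all_analysis.
From mathcomp Require Import ring lra.

Set Implicit Arguments.
Unset Strict Implicit.
Unset Printing Implicit Defensive.

Import Order.TTheory GRing.Theory Num.Theory.

Local Open Scope ring_scope.

(** * Binary digits and truncations *)

Lemma half_truncn_double (R : realType) (y : R) :
  0 <= y -> (Num.truncn (2 * y))./2 = Num.truncn y.
Proof.
move=> y0; symmetry; apply: truncn_def.
have /truncn_itv/andP[] : 0 <= 2 * y by rewrite mulr_ge0.
have := odd_double_half (Num.truncn (2 * y)).
set m := Num.truncn _ => mE; rewrite -[in m.+1]addn1 natrD.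
have {mE} -> : m%:R = (odd m)%:R + 2 * (m./2)%:R :> R.
  by rewrite -{1}mE natrD -mul2n natrM.
rewrite -[in _.+1]addn1 natrD.
by case: (odd m) => /= ? ?; apply/andP; split; lra.
Qed.

(** The truncation of [2 ^+ k.+1 * x] is twice that of [2 ^+ k * x] plus its own parity, which is
    the next digit. *)
Lemma sum_binary_digit (R : realType) (x : R) k : 0 <= x <= 1 ->
  \sum_(j < k.+1) ((binary_digit j x)%:R : R) / 2 ^+ j =
  (Num.truncn (2 ^+ k * x))%:R / 2 ^+ k.
Proof.
move=> /andP[x0 x1]; elim: k => [|k IHk].
  rewrite big_ord1 /binary_digit !expr0 !mul1r !divr1; congr _%:R.
  (* As [x <= 1], the integer part is 0 or 1, hence equal to its parity. *)
  have : (Num.truncn x <= 1)%N by rewrite truncn_le_nat; lra.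
  by case: (Num.truncn x) => [|[|]].
rewrite big_ord_recr /= {}IHk /binary_digit exprS -mulrA.
have y0 : 0 <= 2 ^+ k * x by rewrite mulr_ge0 ?exprn_ge0.
rewrite -(half_truncn_double y0); set m := Num.truncn _.
rewrite -[in RHS](odd_double_half m) natrD -mul2n natrM.
have : 2 ^+ k != 0 :> R by rewrite expf_neq0.
by move=> k0; field.
Qed.

(** Abel summation: on the right, [d j] is counted once for each [k < j]. *)
Lemma sum_mulrn_tails (R : pzRingType) (d : nat -> R) K :
  \sum_(j < K.+1) d j *+ j =
  \sum_(k < K) (\sum_(j < K.+1) d j - \sum_(j < k.+1) d j).
Proof.
pose D k := \sum_(j < k) d j.
have DS k : D k.+1 = D k + d k by rewrite /D big_ord_recr.
elim: K => [|K IHK]; first by rewrite big_ord0 big_ord1.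
rewrite big_ord_recr /= IHK [RHS]big_ord_recr /=.
rewrite -/(D K.+2) -/(D K.+1) (DS K.+1) [_ + _ - D K.+1]addrAC subrr add0r.
rewrite [in RHS](eq_bigr (fun k : 'I_K => D K.+1 - D k.+1 + d K.+1)).
  by rewrite [in RHS]big_split /= sumr_const card_ord mulrSr addrA.
by move=> k _; rewrite -/(D k.+1) addrAC.
Qed.

(* A walk ending after [k] binary choices has dyadic probability with
   denominator [2 ^ k], so the mass [a] stopped within [k] steps is at most the
   truncation of [x] to [k] binary digits. *)
Lemma digit_tails_le (R : realType) (x : R) (a : nat -> R) K : 0 <= x <= 1 ->
  (forall k, 2 ^+ k * a k \is a Num.nat) ->
  (forall k, \sum_(j < k) a j <= x) ->
  \sum_(k < K.+1) (k%:R : R) / 2 ^+ k * (binary_digit k x)%:R <=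
  \sum_(k < K) (x - \sum_(j < k.+1) a j).
Proof.
move=> x01 a_nat a_le; have /andP[x0 _] := x01.
pose d k : R := (binary_digit k x)%:R / 2 ^+ k.
have dE k : k%:R / 2 ^+ k * (binary_digit k x)%:R = d k *+ k.
  by rewrite -mulr_natr /d; ring.
under eq_bigr do rewrite dE.
rewrite sum_mulrn_tails; apply: ler_sum => k _; apply: lerB.
  rewrite sum_binary_digit// ler_pdivrMr ?exprn_gt0// mulrC truncn_le.
  by rewrite mulr_ge0 ?exprn_ge0.
rewrite sum_binary_digit// ler_pdivlMr ?exprn_gt0// mulrC.
have /natrP[m mE] : 2 ^+ k * \sum_(j < k.+1) a j \is a Num.nat.
  rewrite mulr_sumr rpred_sum// => j _.
  have -> : 2 ^+ k = 2 ^+ (k - j) * 2 ^+ j :> R by rewrite -exprD subnK // -ltnS.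
  rewrite -mulrA.
  by rewrite rpredM// rpredX// rpred_nat.
rewrite mE ler_nat truncn_ge_nat -?mE ?mulr_ge0 ?exprn_ge0//.
by rewrite ler_wpM2l ?exprn_ge0.
Qed.

(** * Vertex flows and the halving process *)

Definition flow_in (R : realType) (G : splitter_network) (t : arcs G -> R) v : R :=
  \sum_(e in in_arcs G v) t e.

Definition flow_out (R : realType) (G : splitter_network) (t : arcs G -> R) v : R :=
  \sum_(e in out_arcs G v) t e.

Lemma sum_flow_in (R : realType) (G : splitter_network) (t : arcs G -> R) :
  \sum_e t e = \sum_s flow_in t (splitter_vertex s) +
               \sum_o flow_in t (output_vertex o).
Proof.
rewrite (partition_big (@tgt _ G) predT) //= !big_sumType /=.
rewrite [X in X + _ + _]big1 ?add0r => [|i _].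
  by congr (_ + _); apply: eq_bigr => v _; apply: eq_bigl => e; rewrite inE.
apply: big1 => e eE; have := finset.in_set0 e.
by rewrite -(cards0_eq (in_input i)) inE eE.
Qed.

Lemma sum_flow_out (R : realType) (G : splitter_network) (t : arcs G -> R) :
  \sum_e t e = \sum_i flow_out t (input_vertex i) +
               \sum_s flow_out t (splitter_vertex s).
Proof.
rewrite (partition_big (@src _ G) predT) //= !big_sumType /=.
rewrite [X in _ + _ + X]big1 ?addr0 => [|o _].
  by congr (_ + _); apply: eq_bigr => v _; apply: eq_bigl => e; rewrite inE.
apply: big1 => e eE; have := finset.in_set0 e.
by rewrite -(cards0_eq (out_output o)) inE eE.
Qed.

(* [spread a k e] is the mass on [e] after [k] steps when each input [i] emits
   mass [a i] and every splitter halves the mass it receives. *)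
Fixpoint spread (R : realType) (G : splitter_network) (a : input G -> R)
    (k : nat) (e : arcs G) : R :=
  match k, src e with
  | 0, inl (inl i) => a i
  | k'.+1, inl (inr s) => flow_in (spread a k') (splitter_vertex s) / 2
  | _, _ => 0
  end.

Lemma spreadZ (R : realType) (G : splitter_network) (x : R) (a : input G -> R) k e :
  spread (fun i => x * a i) k e = x * spread a k e.
Proof.
elim: k e => [|k IHk] e /=; case: (src e) => [[i|s]|o]; rewrite ?mulr0//.
by rewrite mulrA /flow_in mulr_sumr; under eq_bigr do rewrite IHk.
Qed.

Lemma spread_sum (R : realType) (G : splitter_network) (J : finType)
    (a : J -> input G -> R) k e :
  spread (fun i => \sum_j a j i) k e = \sum_j spread (a j) k e.
Proof.
elim: k e => [|k IHk] e /=; case: (src e) => [[i|s]|o] //; try by rewrite big1.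
rewrite -mulr_suml /flow_in exchange_big /=; congr (_ / 2).
by apply: eq_bigr => f _; rewrite IHk.
Qed.

Lemma spread_dyadic (R : realType) (G : splitter_network) (a : input G -> R) k e :
  (forall i, a i \is a Num.nat) -> 2 ^+ k * spread a k e \is a Num.nat.
Proof.
move=> a_nat; elim: k e => [|k IHk] e /=.
  by rewrite mul1r; case: (src e) => [[i|s]|o].
case: (src e) => [[i|s]|o]; rewrite ?mulr0 ?rpred0//.
rewrite exprSr -mulrA (mulrC 2) divfK// mulr_sumr.
by rewrite rpred_sum.
Qed.

Lemma flow_out_spread0 (R : realType) (G : splitter_network) (a : input G -> R) i :
  flow_out (spread a 0) (input_vertex i) = a i.
Proof.
rewrite /flow_out; have /eqP/cards1P[e eE] := out_input i.
rewrite eE big_set1 /=; have : e \in [set e]%SET by rewrite inE.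
by rewrite -eE inE => /eqP->.
Qed.

Lemma flow_out_spreadS (R : realType) (G : splitter_network) (a : input G -> R) k s :
  flow_out (spread a k.+1) (splitter_vertex s) =
  flow_in (spread a k) (splitter_vertex s).
Proof.
rewrite {1}/flow_out (eq_bigr (fun=> flow_in (spread a k) (splitter_vertex s) / 2)).
  by rewrite sumr_const out_splitter mulr2n -splitr.
by move=> e; rewrite inE /= => /eqP->.
Qed.

(** Splitters pass on all they receive and outputs absorb it, so the mass still moving is the
    emitted mass minus what has reached the outputs. *)
Lemma sum_spread (R : realType) (G : splitter_network) (a : input G -> R) k :
  \sum_e spread a k e =
  \sum_i a i - \sum_(j < k) \sum_o flow_in (spread a j) (output_vertex o).
Proof.
elim: k => [|k IHk].
  rewrite big_ord0 subr0 sum_flow_out [X in _ + X]big1 => [|s _].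
    by rewrite addr0; apply: eq_bigr => i _; rewrite flow_out_spread0.
  by rewrite /flow_out big1// => e; rewrite inE /= => /eqP->.
rewrite big_ord_recr /= opprD addrA -IHk sum_flow_in addrK.
rewrite sum_flow_out [X in X + _]big1 ?add0r => [|i _].
  by apply: eq_bigr => s _; rewrite flow_out_spreadS.
by rewrite /flow_out big1// => e; rewrite inE /= => /eqP->.
Qed.

(** Past time 0, the cumulated mass on an arc leaving a splitter is half of what entered it one step
    earlier. As [P] is closed under predecessors, the induction on [K] bounds that inflow. *)
Lemma sum_spread_le (R : realType) (G : splitter_network) (a : input G -> R)
    (P : pred (arcs G)) (t : arcs G -> R) K e :
  (forall e, 0 <= t e) ->
  (forall e f, tgt e = src f -> P f -> P e) ->
  (forall i e, src e = input_vertex i -> P e -> a i <= t e) ->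
  (forall s e, src e = splitter_vertex s -> P e ->
    flow_in t (splitter_vertex s) / 2 <= t e) ->
  P e -> \sum_(k < K) spread a k e <= t e.
Proof.
move=> t0 Pback Pin Psplit; elim: K e => [|K IHK] e Pe; first by rewrite big_ord0.
rewrite big_ord_recl /=; case eE: (src e) => [[i|s]|o]; last by rewrite big1 ?addr0.
  by rewrite big1 ?addr0//; apply: Pin.
rewrite add0r; apply: le_trans (Psplit s e eE Pe).
rewrite -mulr_suml ler_wpM2r ?invr_ge0// /flow_in exchange_big /=.
apply: ler_sum => f; rewrite inE => /eqP fE.
by apply: IHK; apply: Pback Pe; rewrite eE.
Qed.

(** * Throughput in steady states *)

(** A fluid arc carries the larger of the two outgoing throughputs, whose sum is the inflow. *)
Lemma fluid_out_half (R : realType) (G : splitter_network)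
    (c : input G + output G -> R) (t : arcs G -> R) (F : {set arcs G}) s e :
  steady_state c t F -> src e = splitter_vertex s -> e \in F ->
  flow_in t (splitter_vertex s) / 2 <= t e.
Proof.
move=> st es eF; rewrite /flow_in (conservation_rule st s).
have /eqP/cards2P[e1 [e2 [e12 outE]]] := out_splitter s.
have : e \in out_arcs G (splitter_vertex s) by rewrite inE es.
have := fluid_out_rule st (s := s).
rewrite /splitter_vertex outE big_setU1 ?inE//= big_set1 => fl.
case/orP=> /eqP eE; subst e.
  by have := fl e1 e2 erefl eF; lra.
by have := fl e2 e1 (finset.setUC _ _) eF; lra.
Qed.

Lemma steady_in_le_out (R : realType) (G : splitter_network)
    (c : input G + output G -> R) (t : arcs G -> R) (F : {set arcs G}) :
  steady_state c t F ->
  \sum_o flow_in t (output_vertex o) <= \sum_i c (inl i).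
Proof.
move=> st; have := sum_flow_in t; rewrite sum_flow_out addrC.
under eq_bigr => s _ do rewrite /flow_out -(conservation_rule st s).
move=> /addrI <-; apply: ler_sum => i _.
have /eqP/cards1P[e eE] := out_input i.
by rewrite /flow_out eE big_set1; case: (input_rule st eE).
Qed.

Definition arc_next (G : splitter_network) : rel (arcs G) :=
  [rel e f | tgt e == src f].

(* If [e] is saturated and [f] fluid, maximality makes one of them carry 1, and
   the fluid-out rule then gives [f] at least 1/2. *)
Lemma heavy_next (R : realType) (G : splitter_network)
    (c : input G + output G -> R) (t : arcs G -> R) (F : {set arcs G}) k e f :
  steady_state c t F -> tgt e = src f ->
  e \notin F \/ 2^-1 ^+ k <= t e -> f \notin F \/ 2^-1 ^+ k.+1 <= t f.
Proof.
move=> st ef heavy; have [fF|] := boolP (f \in F); [right|by left].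
have t01 := throughput_bounds st.
case fE: (src f) => [[i|s]|o].
- have := finset.in_set0 e.
  by rewrite -(cards0_eq (in_input i)) inE ef fE eqxx.
- have half := fluid_out_half st fE fF.
  have le_in : t e <= flow_in t (splitter_vertex s).
    rewrite /flow_in (bigD1 e) /=; last by rewrite inE ef fE.
    by rewrite lerDl sumr_ge0// => g _; case/andP: (t01 g).
  have pow1 : (2^-1 : R) ^+ k <= 1 by rewrite exprn_ile1// ?invr_ge0//; lra.
  rewrite exprS; case: heavy => [eF|?]; last by lra.
  by case: (maximality_rule st ef eF fF); lra.
- have := finset.in_set0 f.
  by rewrite -(cards0_eq (out_output o)) inE fE eqxx.
Qed.

(** From a saturated [e], each arc of a path loses at most a factor 2, so the output arc [f] would
    carry more than the whole input. *)
Lemma connect_output_fluid (R : realType) (G : splitter_network)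
    (c : input G + output G -> R) (t : arcs G -> R) (F : {set arcs G}) e f :
  steady_state c t F -> (forall o, c (inr o) = 1) ->
  \sum_i c (inl i) <= 2^-1 ^+ #|arcs G| ->
  f \in output_arcs G -> connect (@arc_next G) e f -> e \in F.
Proof.
move=> st c1 c_small /bigcupP[q _ fo] /connectP[p0 p0P fE].
apply/negPn/negP => eF.
have t0 g : 0 <= t g by case/andP: (throughput_bounds st g).
have [h0 h1] : 0 < (2^-1 : R) /\ (2^-1 : R) < 1.
  by rewrite invr_gt0 invf_lt1 ?ltr1n ?ltr0n.
have tf_small : t f <= 2^-1 ^+ #|arcs G|.
  apply: le_trans c_small; apply: le_trans (steady_in_le_out st).
  apply: (@le_trans _ _ (flow_in t (output_vertex q))).
    by rewrite /flow_in (bigD1 f) //= lerDl sumr_ge0.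
  by rewrite (bigD1 q) //= lerDl sumr_ge0// => o' _; apply: sumr_ge0.
have heavy_path p g k : path (@arc_next G) g p ->
    g \notin F \/ 2^-1 ^+ k <= t g ->
    last g p \notin F \/ 2^-1 ^+ (k + size p) <= t (last g p).
  elim: p g k => [|h p IHp] g k /=; first by rewrite addn0.
  move=> /andP[/eqP gh hp] /(heavy_next st gh) hk.
  by rewrite addnS -addSn; apply: IHp.
(* A path without repeated arcs makes fewer than [#|arcs G|] halvings. *)
case/shortenP: p0P fE => p pP p_uniq _ fE.
have p_small : (size p < #|arcs G|)%N.
  by rewrite -[(size p).+1]/(size (e :: p)) -(card_uniqP p_uniq) max_card.
have tf_lt : t f < 2^-1 ^+ size p.
  by apply: le_lt_trans tf_small _; rewrite ltr_iXn2l.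
have := heavy_path p e 0 pP (or_introl eF); rewrite -fE add0n.
case=> [fF|]; last by rewrite leNgt tf_lt.
(* If [f] itself is saturated, the output rule forces [t f = 1], which is again too large. *)
have foE : in_arcs G (output_vertex q) = [set f]%SET.
  have /eqP/cards1P[g gE] := in_output q.
  by move: fo; rewrite /output_vertex gE inE => /eqP->.
have [_ /(_ fF) tf1] := output_rule st foE.
by move: tf_lt; rewrite tf1 c1 ltNge exprn_ile1// ltW.
Qed.

(** * Bounds on the halving mass *)

Lemma output_mass_le (R : realType) (G : splitter_network) i o K :
  balancer R G ->
  \sum_(k < K) flow_in (spread (fun j : input G => (j == i)%:R : R) k)
                       (output_vertex o) <= (#|output G|%:R)^-1.
Proof.
move=> bal; pose a (j : input G) : R := (j == i)%:R; rewrite -/a.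
(* The largest total input allowed by [connect_output_fluid]; the factor [x] cancels at the end by
   linearity of [spread]. *)
pose x : R := 2^-1 ^+ #|arcs G|.
have x0 : 0 < x by rewrite exprn_gt0 ?invr_gt0.
have x1 : x <= 1 by rewrite exprn_ile1 ?invr_ge0 ?invf_le1 ?ler1n.
pose c (v : input G + output G) := if v is inl j then x * a j else 1.
have sum_c : \sum_j c (inl j) = x.
  rewrite (bigD1 i) //= /a eqxx mulr1 big1 ?addr0// => j /negPf->.
  by rewrite mulr0.
have cap_c : is_capacity c.
  case=> [j|p] /=; rewrite ?ler01 ?lexx// /a; case: eqP => _.
    by rewrite mulr1 ltW.
  by rewrite mulr0 lexx ler01.
have [|] := bal c cap_c; first by [].
move=> t [F [st t_const]].
have t0 g : 0 <= t g by case/andP: (throughput_bounds st g).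
(* Arcs that lead to an output: closed under predecessors, and all fluid. *)
pose P e := [exists f in output_arcs G, connect (@arc_next G) e f].
have PF e : P e -> e \in F.
  case/exists_inP => f fo; apply: connect_output_fluid st _ _ fo => //.
  by rewrite sum_c.
have [e eE] : exists e, in_arcs G (output_vertex o) = [set e]%SET.
  by apply/cards1P; rewrite in_output.
have out_arc p f : f \in in_arcs G (output_vertex p) -> f \in output_arcs G.
  by move=> fp; apply/bigcupP; exists p.
have eo : e \in output_arcs G by apply: (out_arc o); rewrite eE inE.
have occ_le : x * (\sum_(k < K) flow_in (spread a k) (output_vertex o)) <= t e.
  rewrite mulr_sumr; under eq_bigr do rewrite /flow_in eE big_set1 -spreadZ.
  apply: (@sum_spread_le _ _ _ P) => //.
  - move=> g h gh /exists_inP[f fo hf]; apply/exists_inP; exists f => //.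
    by apply: connect_trans hf; apply: connect1; apply/eqP.
  - move=> j g gj /PF gF; have : g \in out_arcs G (input_vertex j) by rewrite inE gj.
    have /eqP/cards1P[h hE] := out_input j; rewrite /input_vertex hE inE => /eqP gh.
    by subst h; have [_ ->] := input_rule st hE.
  - by move=> s g gs /PF; apply: fluid_out_half st gs.
  - by apply/exists_inP; exists e.
(* By balance every output arc carries [t e], and together they carry at most the input [x]. *)
have te_le : #|output G|%:R * t e <= x.
  rewrite -sum_c; apply: le_trans (steady_in_le_out st).
  rewrite mulr_natl -sumr_const; apply: ler_sum => p _.
  have /eqP/cards1P[f fE] := in_output p.
  rewrite /flow_in /output_vertex fE big_set1 (t_const e f)//.
  by apply: (out_arc p); rewrite /output_vertex fE inE.
have p_gt0 : 0 < #|output G|%:R :> R by rewrite ltr0n; apply/card_gt0P; exists o.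
rewrite -[_^-1]mul1r ler_pdivlMr// -(ler_pM2l x0) mulr1 mulrA.
by apply: le_trans te_le; rewrite mulrC ler_pM2l.
Qed.

(** By linearity all inputs emit at once. With every arc fluid, the cumulated mass on each of the
    two arcs leaving a splitter is at most its throughput, hence at most 1. *)
Lemma fluid_spread_le (R : realType) (G : splitter_network) (t : arcs G -> R) K :
  steady_state (fun=> 1) t [set: arcs G]%SET ->
  \sum_(k < K) \sum_i \sum_e spread (fun j : input G => (j == i)%:R : R) k.+1 e <=
  2 * #|splitter G|%:R.
Proof.
move=> st; have t01 := throughput_bounds st.
have -> : \sum_(k < K) \sum_i \sum_e
      spread (fun j : input G => (j == i)%:R : R) k.+1 e =
    \sum_(k < K) \sum_(e : arcs G) spread (fun=> 1 : R) k.+1 e.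
  apply: eq_bigr => k _; rewrite exchange_big; apply: eq_bigr => e _.
  rewrite -spread_sum; congr (spread _ _ e); apply/funext => j.
  by rewrite (bigD1 j) //= eqxx big1 ?addr0// => l; rewrite eq_sym => /negPf->.
rewrite exchange_big sum_flow_out [X in X + _]big1 ?add0r => [|i _]; last first.
  by apply: big1 => e; rewrite inE => /eqP eE; apply: big1 => k _ /=; rewrite eE.
rewrite mulr_natr -sumr_const; apply: ler_sum => s _.
apply: (@le_trans _ _ (\sum_(e in out_arcs G (splitter_vertex s)) 1)); last first.
  by rewrite sumr_const out_splitter.
apply: ler_sum => e; rewrite inE => _.
have /andP[_] := t01 e; apply: le_trans.
(* The nonnegative time 0 term is restored to apply [sum_spread_le]. *)
apply: le_trans (_ : \sum_(k < K.+1) spread (fun=> 1 : R) k e <= t e).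
  by rewrite big_ord_recl lerDr /=; case: (src e) => [[]|] *; rewrite ?lexx ?ler01.
apply: (@sum_spread_le _ _ _ predT) => //.
- by move=> g; case/andP: (t01 g).
- move=> i g gi _; have /eqP/cards1P[h hE] := out_input i.
  have : g \in out_arcs G (input_vertex i) by rewrite inE gi.
  rewrite /input_vertex hE inE => /eqP gh; subst h.
  by have [_ ->] := input_rule st hE.
- by move=> s' g gs _; apply: fluid_out_half st gs _.
Qed.

Theorem theorem3 (R : realType) (G : splitter_network) (n p : nat)
    (G_balancer : np_balancer R G n p)
    (no_saturated : exists t F,
      steady_state (fun _ : input G + output G => 1 : R) t F /\
      F = [set: arcs G]%SET) :
  ((#|splitter G|%:R : R)%:E >=
   (2^-1 * #|input G|%:R * #|output G|%:R)%:E *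
   \sum_(0 <= k <oo)
     (k%:R / 2 ^+ k * (binary_digit k ((#|output G|%:R : R)^-1))%:R)%:E)%E.
Proof.
case: G_balancer => bal _ _; case: no_saturated => t [F [st FT]].
rewrite {}FT in st.
set C : R := 2^-1 * _ * _; set x : R := _^-1.
have C0 : 0 <= C by rewrite !mulr_ge0 ?invr_ge0.
pose d k : R := k%:R / 2 ^+ k * (binary_digit k x)%:R.
have d0 k : 0 <= d k by rewrite !mulr_ge0 ?invr_ge0 ?exprn_ge0.
rewrite -nneseriesZl => [|k _]; last by rewrite lee_fin; exact: d0.
apply: lime_le.
  by apply: is_cvg_nneseries => k _ _; rewrite -EFinM lee_fin mulr_ge0 ?d0.
apply: nearW => K; rewrite sumEFin lee_fin -mulr_sumr big_mkord.
(* One more nonnegative term gives the range of [digit_tails_le]. *)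
apply: (@le_trans _ _ (C * \sum_(k < K.+1) d k)).
  by rewrite ler_wpM2l// big_ord_recr lerDl.
have [p0|p_gt0] := posnP #|output G|; first by rewrite /C p0 mulr0 mul0r.
have px : #|output G|%:R * x = 1 by rewrite divff// pnatr_eq0 -lt0n.
have x01 : 0 <= x <= 1 by rewrite invr_ge0 ler0n invf_le1 ?ltr0n// ler1n.
pose a i o k := flow_in (spread (fun j : input G => (j == i)%:R : R) k)
                        (output_vertex (o : output G)).
have digits i o :
    \sum_(k < K.+1) d k <= \sum_(k < K) (x - \sum_(j < k.+1) a i o j).
  apply: digit_tails_le => // k; last exact: output_mass_le.
  rewrite mulr_sumr rpred_sum// => e _.
  by apply: spread_dyadic => j; rewrite rpred_nat.
(* Over all outputs the copies of [x] add up to the unit mass emitted by [i], so the tails add up to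
   the mass still moving. *)
have mass : \sum_i \sum_o \sum_(k < K) (x - \sum_(j < k.+1) a i o j) =
    \sum_(k < K) \sum_i \sum_e spread (fun j : input G => (j == i)%:R : R) k.+1 e.
  rewrite [RHS]exchange_big; apply: eq_bigr => i _; rewrite exchange_big.
  apply: eq_bigr => k _; rewrite sum_spread big_split /= sumrN exchange_big /=.
  rewrite sumr_const -mulr_natl px; congr (_ - _).
  by rewrite (bigD1 i) //= eqxx big1 ?addr0// => j /negPf->.
have : #|input G|%:R * #|output G|%:R * \sum_(k < K.+1) d k <=
    2 * #|splitter G|%:R.
  apply: le_trans (fluid_spread_le K st); rewrite -mass -mulrA.
  rewrite mulr_natl -sumr_const.
  by apply: ler_sum => i _; rewrite mulr_natl -sumr_const; apply: ler_sum.
by rewrite /C; lra.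
Qed.
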